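(* Let $(F,A)$ be a soft quasigroup over a finite quasigroup $(Q,\star)$, and let $(Q,\star_i)$, $i=1,2,3,4,5$, be the five parastrophes of $(Q,\star)$. Then: (1) $|(F,A)|_{(Q,\star)}=|(F,A)|_{(Q,\star_i)}$ for each $i=1,2,3,4,5$; (2) $\mathcal{AM}(F,A)_{(Q,\star)}=\mathcal{AM}(F,A)_{(Q,\star_i)}$ for each $i=1,2,3,4,5$; (3) $\mathcal{GM}(F,A)_{(Q,\star)}=\mathcal{GM}(F,A)_{(Q,\star_i)}$ for each $i=1,2,3,4,5$.
   Context: A quasigroup is a nonempty set $Q$ with a binary operation $\star$ such that for all $a,b\in Q$ each of the equations $a\star x=b$ and $y\star a=b$ has a unique solution in $Q$. A nonempty subset $H\subseteq Q$ is a subquasigroup if it is closed under the operation and is a quasigroup under it. The five parastrophes $(Q,\star_i)$, $i=1,\dots,5$, of $(Q,\star)$ are the quasigroups on $Q$ with the operations $\circledast,/,\backslash,//,\backslash\backslash$ defined by: $y\circledast x=z\Leftrightarrow x\star y=z$; $x/y=z\Leftrightarrow z\star y=x$; $x\backslash y=z\Leftrightarrow x\star z=y$; $x//y=z\Leftrightarrow z\star x=y$; $x\backslash\backslash y=z\Leftrightarrow y\star z=x$. A soft set $(F,A)$ over $Q$ consists of a set $A$ of parameters (here nonempty and finite) and a map $F:A\to 2^{Q}\setminus\{\emptyset\}$. For a quasigroup operation $\ast$ on $Q$, $(F,A)_{(Q,\ast)}$ denotes this soft set regarded over $(Q,\ast)$; it is a soft quasigroup if $F(a)$ is a subquasigroup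 of $(Q,\ast)$ for all $a\in A$. For a soft quasigroup $(F,A)$ over a finite quasigroup $(Q,\ast)$, its order is $|(F,A)|_{(Q,\ast)}=\sum_{a\in A}|F(a)|$, where the sum is over distinct proper subquasigroups $F(a)$, $a\in A$; its arithmetic mean and geometric mean are $\mathcal{AM}(F,A)_{(Q,\ast)}=\frac{1}{|A|}\sum_{a\in A}|F(a)|$ and $\mathcal{GM}(F,A)_{(Q,\ast)}=\sqrt[|A|]{\prod_{a\in A}|F(a)|}$. *)

(* Defs.v *)
From mathcomp Require Import all_boot all_order all_algebra.
From mathcomp Require Import boolp reals exp.

Set Implicit Arguments.
Unset Strict Implicit.
Unset Printing Implicit Defensive.

Import Order.TTheory GRing.Theory Num.Theory.

Definition quasigroup (T : Type) (op : T -> T -> T) : Prop :=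
  inhabited T /\
  forall a b : T, (exists! x, op a x = b) /\ (exists! y, op y a = b).

Definition closed_under (Q : finType) (op : Q -> Q -> Q) (H : {set Q}) : Prop :=
  forall a b : Q, a \in H -> b \in H -> op a b \in H.

Definition restr_op (Q : finType) (op : Q -> Q -> Q) (H : {set Q})
    (clH : closed_under op H) (u v : {x : Q | x \in H}) : {x : Q | x \in H} :=
  exist _ (op (val u) (val v)) (clH _ _ (valP u) (valP v)).

(* H is nonempty because the carrier {x | x \in H} of a quasigroup is. *)
Definition subquasigroup (Q : finType) (op : Q -> Q -> Q) (H : {set Q}) : Prop :=
  exists clH : closed_under op H, quasigroup (restr_op clH).

Inductive parastrophe : Type :=
  | ParOpp    (* the opposite operation, circled star *)
  | ParRdiv   (* / *)
  | ParLdiv   (* \ *)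
  | ParOppR   (* // *)
  | ParOppL.  (* \\ *)

Definition is_parastrophe (T : Type) (star : T -> T -> T) (i : parastrophe)
    (op : T -> T -> T) : Prop :=
  match i with
  | ParOpp  => forall x y z, op y x = z <-> star x y = z
  | ParRdiv => forall x y z, op x y = z <-> star z y = x
  | ParLdiv => forall x y z, op x y = z <-> star x z = y
  | ParOppR => forall x y z, op x y = z <-> star z x = y
  | ParOppL => forall x y z, op x y = z <-> star y z = x
  end.

(* The relation is_parastrophe star i is the graph of a function of i when star
   is a quasigroup operation. *)
Lemma parastrophe_exists (T : Type) (star : T -> T -> T) (i : parastrophe) :
  quasigroup star -> exists op, is_parastrophe star i op.
Proof.
case=> _ qg.
have choose2 (P : T -> T -> T -> Prop) :
    (forall x y, exists! z, P x y z) ->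
    exists op : T -> T -> T, forall x y z, op x y = z <-> P x y z.
  move=> uniqP.
  pose op x y := projT1 (cid (uniqP x y)).
  exists op => x y z; rewrite /op; case: cid => w /= [Pw uw].
  by split=> [<- //|/uw].
case: i => /=.
- by exists (fun y x => star x y).
- by apply: (choose2 (fun x y z => star z y = x)) => x y; case: (qg y x).
- by apply: (choose2 (fun x y z => star x z = y)) => x y; case: (qg x y).
- by apply: (choose2 (fun x y z => star z x = y)) => x y; case: (qg x y).
- by apply: (choose2 (fun x y z => star y z = x)) => x y; case: (qg y x).
Qed.

Lemma parastrophe_unique (T : Type) (star : T -> T -> T) (i : parastrophe)
    (op op' : T -> T -> T) :
  is_parastrophe star i op -> is_parastrophe star i op' ->
  forall x y, op x y = op' x y.
Proof.
by case: i => /= h h' x y; apply/h/h'.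
Qed.

Record soft_set (Q A : finType) := SoftSet {
  soft_map :> A -> {set Q};
  soft_map_neq0 : forall a, soft_map a != set0 }.

Definition soft_quasigroup (Q A : finType) (op : Q -> Q -> Q)
    (F : soft_set Q A) : Prop :=
  forall a, subquasigroup op (F a).

(* The order and the two means are only defined for a soft set that is a soft
   quasigroup over (Q, op), hence the proof argument. *)

(* Each distinct set F a is counted once, as the sum ranges over the image of
   F; a proper subquasigroup is one different from Q. *)
Definition soft_order (Q A : finType) (op : Q -> Q -> Q) (F : soft_set Q A)
    (_ : soft_quasigroup op F) : nat :=
  \sum_(H in [set F a | a : A] | `[< subquasigroup op H >] &&
                                 (H \proper [set: Q])) #|H|.

Definition arith_mean (R : realType) (Q A : finType) (op : Q -> Q -> Q)
    (F : soft_set Q A) (_ : soft_quasigroup op F) : R :=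
  ((#|A|%:R)^-1 * \sum_(a : A) #|F a|%:R)%R.

Definition geom_mean (R : realType) (Q A : finType) (op : Q -> Q -> Q)
    (F : soft_set Q A) (_ : soft_quasigroup op F) : R :=
  ((\prod_(a : A) #|F a|%:R) `^ (#|A|%:R)^-1)%R.

(* Main.v *)
Require Import Defs.
From mathcomp Require Import all_boot all_order all_algebra.
From mathcomp Require Import boolp reals exp.

(** A quasigroup operation is the same thing as a set of triples (x, y, z), the
    graph x * y = z, in which any two coordinates determine the third; passing
    to a parastrophe only permutes the coordinates.  The subquasigroups are the
    nonempty subsets H such that a triple of the graph with two coordinates in
    H has its third coordinate in H as well ([subquasigroupP]).  This condition
    is symmetric in the three coordinates, so a subquasigroup of a quasigroup
    is a subquasigroup of each of its parastrophes
    ([subquasigroup_parastrophe]).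

    Hence a soft quasigroup F over a quasigroup is one over each parastrophe.
    The means depend on the cardinals #|F a| alone, and in the order the
    condition of being a subquasigroup holds for all the sets F a, whichever of
    the operations is used. *)

Lemma exists_unique_iff (T : Type) (P P' : T -> Prop) :
  (forall x, P x <-> P' x) -> (exists! x, P' x) -> exists! x, P x.
Proof.
move=> PP' [x [P'x ux]]; exists x; split; first exact/PP'.
by move=> y /PP'; apply: ux.
Qed.

Lemma exists_unique_eq (T : Type) (x : T) : exists! y, x = y.
Proof. by exists x. Qed.

(** In each case, one of the two equations to solve becomes an equation for the
    original operation, and the other one becomes either the other equation or
    the evaluation of a product. *)
Lemma quasigroup_parastrophe {T : Type} {star : T -> T -> T} {i : parastrophe}
    {op : T -> T -> T} :
  quasigroup star -> is_parastrophe star i op -> quasigroup op.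
Proof.
case=> inhT qg par; split=> // a b.
have [[Lab Rab] [Lba Rba]] := (qg a b, qg b a).
by case: i par => /= par; split; apply: exists_unique_iff;
  do ?[by move=> x; apply: par]; do ?[exact: exists_unique_eq].
Qed.

(** The two-out-of-three condition on the graph of the operation, which unlike
    closure under the operation treats the three coordinates alike. *)
Definition two_out_of_three {Q : finType} (op : Q -> Q -> Q) (H : {set Q}) :
    Prop :=
  forall x y z, op x y = z ->
    [/\ x \in H -> y \in H -> z \in H,
        x \in H -> z \in H -> y \in H
      & y \in H -> z \in H -> x \in H].

(** A solution in H of an equation with coefficients in H is the solution in
    the whole quasigroup, by uniqueness there: solvability within H amounts to
    the solution in the quasigroup lying in H. *)
Lemma subquasigroupP {Q : finType} {op : Q -> Q -> Q} (H : {set Q}) :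
  quasigroup op ->
  subquasigroup op H <-> H != set0 /\ two_out_of_three op H.
Proof.
case=> _ qg; split.
  case=> clH [[[u Hu]] qgH]; split; first by apply/set0Pn; exists u.
  move=> x y z xyz; split=> [Hx Hy|Hx Hz|Hy Hz].
  - by rewrite -xyz; exact: (clH x y).
  - have [[v [/(congr1 val) /= xvz _]] _] := qgH (exist _ x Hx) (exist _ z Hz).
    have [[w [_ uw]] _] := qg x z.
    by rewrite -(uw _ xyz) (uw _ xvz); apply: valP.
  - have [_ [v [/(congr1 val) /= vyz _]]] := qgH (exist _ y Hy) (exist _ z Hz).
    have [_ [w [_ uw]]] := qg y z.
    by rewrite -(uw _ xyz) (uw _ vyz); apply: valP.
case=> /set0Pn[u Hu] tot.
have clH : closed_under op H.
  by move=> x y Hx Hy; have [+ _ _] := tot x y _ erefl; apply.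
exists clH; split; first by constructor; exists u.
move=> [a Ha] [b Hb].
have [[x [axb ux]] [y [yab uy]]] := qg a b.
have Hx : x \in H by have [_ + _] := tot _ _ _ axb; apply.
have Hy : y \in H by have [_ _ +] := tot _ _ _ yab; apply.
split.
- exists (exist _ x Hx); split; first exact: val_inj.
  by move=> v /(congr1 val) /= avb; apply: val_inj; apply: ux.
- exists (exist _ y Hy); split; first exact: val_inj.
  by move=> v /(congr1 val) /= vab; apply: val_inj; apply: uy.
Qed.

Lemma two_out_of_three_parastrophe {Q : finType} {star : Q -> Q -> Q}
    {i : parastrophe} {op : Q -> Q -> Q} {H : {set Q}} :
  is_parastrophe star i op -> two_out_of_three star H ->
  two_out_of_three op H.
Proof.
by case: i => /= par tot x y z /par /tot[Hz Hy Hx]; split=> ? ?; auto.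
Qed.

Lemma subquasigroup_parastrophe {Q : finType} {star : Q -> Q -> Q}
    {i : parastrophe} {op : Q -> Q -> Q} {H : {set Q}} :
  quasigroup star -> is_parastrophe star i op ->
  subquasigroup star H -> subquasigroup op H.
Proof.
move=> qg par /(subquasigroupP H qg)[H0 tot].
apply/(subquasigroupP H (quasigroup_parastrophe qg par)); split=> //.
exact: two_out_of_three_parastrophe par tot.
Qed.

(** The order does not depend on the operation: the summation condition that
    F a be a subquasigroup is met by all the sets F a. *)
Lemma soft_orderE {Q A : finType} {op : Q -> Q -> Q} {F : soft_set Q A}
    (hF : soft_quasigroup op F) :
  soft_order hF = \sum_(H in [set F a | a : A] | H \proper [set: Q]) #|H|.
Proof.
apply: eq_bigl => H; case: imsetP => //= -[a _ ->].
by rewrite (asboolT (hF a)).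
Qed.

Theorem theorem3p6 (R : realType) (Q : finType) (star : Q -> Q -> Q)
    (hstar : quasigroup star)
    (star_ : parastrophe -> Q -> Q -> Q)
    (hstar_ : forall i : parastrophe, is_parastrophe star i (star_ i))
    (A : finType) (hA : 0 < #|A|) (F : soft_set Q A)
    (hF : soft_quasigroup star F) :
  exists hF_ : forall i : parastrophe, soft_quasigroup (star_ i) F,
    [/\ forall i : parastrophe, soft_order hF = soft_order (hF_ i),
        forall i : parastrophe, arith_mean R hF = arith_mean R (hF_ i)
      & forall i : parastrophe, geom_mean R hF = geom_mean R (hF_ i)].
Proof.
have hF_ i : soft_quasigroup (star_ i) F.
  by move=> a; apply: subquasigroup_parastrophe hstar (hstar_ i) (hF a).
by exists hF_; split=> // i; rewrite !soft_orderE.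
Qed.
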